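(* Let $1\le p<\infty$. Suppose that for every integer $i\ge 0$: if $1<p<\infty$ then $C_i<\infty$, while if $p=1$ then $B_i<\infty$ for some integer $N_i\in\mathbb{N}$ with $N_i\ge i$; and $\lim_{M\to\infty}b^i_{M,k}=0$ for every integer $k\ge 1$. Then the set of closed invariant subspaces of $M_{\diamond,z}$ on $\ell^p(\beta)$ is $\mathrm{Lat}(M_{\diamond,z})=\{\ell^p_i(\beta): i\in\{0,1,2,\dots\}\cup\{\infty\}\}$, and so $M_{\diamond,z}$ is a unicellular operator on $(\ell^p(\beta),\diamond)$.
   Context: Let $\{\beta(n)\}_{n\ge 0}$ and $\{\delta_n\}_{n\ge 0}$ be sequences of positive numbers with $\beta(0)=1$ and $\delta_0=1$; $\mathbb{N}=\{1,2,\dots\}$. For $1\le p<\infty$, $\ell^p(\beta)$ is the Banach space of complex sequences $f=\{\hat f(n)\}_{n\ge 0}$, written as formal power series $f(z)=\sum_{n\ge 0}\hat f(n)z^n$ (no convergence required), with $\|f\|_\beta^p=\sum_{n\ge 0}|\hat f(n)|^p\beta(n)^p<\infty$. The weighted Cauchy product is $f\diamond g=\sum_{n\ge 0}\sum_{m\ge 0}\frac{\delta_{n+m}}{\delta_n\delta_m}\hat f(n)\hat g(m)z^{n+m}$, and $M_{\diamond,z}(f)=z\diamond f=\sum_{n\ge 0}\frac{\delta_{n+1}}{\delta_n\delta_1}\hat f(n)z^{n+1}$. For integers $i\ge 0$, $\ell^p_i(\beta)=\{f\in\ell^p(\beta):\hat f(n)=0\text{ for all }n<i\}$, so $\ell^p_0(\beta)=\ell^p(\beta)$;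 and $\ell^p_\infty(\beta)=\{0\}$. For integers $i\ge0$, $M\ge 0$, $k\ge 0$ put (with $q$ the conjugate exponent of $p$ when $1<p<\infty$) $$C_i=\sup_{n\ge i}\sum_{k=i}^{n}\left(\frac{\delta_n\beta(n)}{\delta_k\delta_{n-k+i}\beta(k)\beta(n-k+i)}\right)^{q},\qquad b^i_{M,k}=\sup_{n\ge M+i+1}\frac{\delta_{n+k}\beta(n+k)}{\delta_n\delta_{k+i}\beta(n)\beta(k+i)},$$ and, for $p=1$, $B_i=\sum_{n,m\ge N_i+1}\frac{\delta_{n+m-i}\beta(n+m-i)}{\delta_n\delta_m\beta(n)\beta(m)}$. A bounded operator is unicellular if its set of closed invariant subspaces is linearly ordered by inclusion. *)

(* Defs.v *)
From HB Require Import structures.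
From mathcomp Require Import all_boot all_order all_algebra.
From mathcomp Require Import all_classical all_reals all_analysis.
From mathcomp Require Import complex.

Set Implicit Arguments.
Unset Strict Implicit.
Unset Printing Implicit Defensive.

Import Order.TTheory GRing.Theory Num.Theory.
Import numFieldNormedType.Exports.
Import ComplexField.Normc.

Local Open Scope classical_set_scope.
Local Open Scope ring_scope.
Local Open Scope complex_scope.

(* The exponent [^o] makes R[i] a module over itself, so that sequences carry
   the pointwise complex vector space structure. *)
Notation cseq R := (nat -> R[i]^o).

Section Lpbeta_def.
Context {R : realType} (p : R) (beta : R^nat).

(* \|f\|_beta^p in [0, +oo]; normc is the real-valued modulus *)
Definition lpbeta_sum (f : cseq R) : \bar R :=
  (\sum_(0 <= n <oo) (normc (f n) `^ p * beta n `^ p)%:E)%E.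

Definition lpbeta_norm (f : cseq R) : R := fine (lpbeta_sum f) `^ p^-1.

End Lpbeta_def.

Section Lpbeta_norm_theory.
Context {R : realType} {p : R} {beta : R^nat}.
Hypotheses (p1 : 1 <= p) (beta_gt0 : forall n, 0 < beta n).
Implicit Types f g : cseq R.

Let p0 : 0 < p. Proof. exact: lt_le_trans p1. Qed.

Lemma normc_ge0 (x : R[i]) : 0 <= normc x.
Proof. by case: x => a b; rewrite sqrtr_ge0. Qed.

Lemma lpbeta_sum_ge0 f : (0 <= lpbeta_sum p beta f)%E.
Proof.
by apply: nneseries_ge0 => n _ _; rewrite lee_fin mulr_ge0// powR_ge0.
Qed.

Let wabs f : nat -> R := fun n => normc (f n) * beta n.

Let wabs_ge0 f n : 0 <= wabs f n.
Proof. by rewrite mulr_ge0 ?normc_ge0 ?ltW. Qed.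

Let wabs_powR f n : wabs f n `^ p = normc (f n) `^ p * beta n `^ p.
Proof. by rewrite powRM ?normc_ge0 ?ltW. Qed.

Let Lnorm_wabs f :
  Lnorm counting p%:E (EFin \o wabs f) = (lpbeta_sum p beta f `^ p^-1)%E.
Proof.
rewrite Lnorm_counting//; congr (_ `^ _)%E; apply: eq_eseriesr => n _.
by rewrite -wabs_powR /= -[in RHS](ger0_norm (wabs_ge0 f n)).
Qed.

Let lpbeta_minkowski f g :
  (lpbeta_sum p beta (f + g)%R `^ p^-1 <=
   lpbeta_sum p beta f `^ p^-1 + lpbeta_sum p beta g `^ p^-1)%E.
Proof.
rewrite -!Lnorm_wabs.
apply: le_trans (minkowski_EFin counting _ _ p1) => //.
rewrite !Lnorm_counting//; apply: gt0_ler_poweR.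
- by rewrite invr_ge0 ltW.
- by rewrite in_itv/= leey andbT nneseries_ge0// => n _ _; rewrite poweR_ge0.
- by rewrite in_itv/= leey andbT nneseries_ge0// => n _ _; rewrite poweR_ge0.
apply: lee_nneseries => n _ /=; first by rewrite lee_fin powR_ge0.
rewrite lee_fin ge0_ler_powR ?nnegrE ?normr_ge0 ?(ltW p0)//.
rewrite !ger0_norm ?addr_ge0//.
by rewrite -mulrDl ler_wpM2r ?(ltW (beta_gt0 n))//; exact: (le_normcD (f n) (g n)).
Qed.

Lemma lpbeta_sumE f : (lpbeta_sum p beta f < +oo)%E ->
  (lpbeta_sum p beta f `^ p^-1)%E = (lpbeta_norm p beta f)%:E.
Proof.
move=> foo; rewrite /lpbeta_norm -poweR_EFin fineK//.
by rewrite ge0_fin_numE ?lpbeta_sum_ge0.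
Qed.

Lemma lpbeta_sumZ (a : R[i]) f :
  lpbeta_sum p beta (a *: f)%R = ((normc a `^ p)%:E * lpbeta_sum p beta f)%E.
Proof.
rewrite /lpbeta_sum -nneseriesZl; last first.
  by move=> n _; rewrite lee_fin mulr_ge0 ?powR_ge0.
apply: eq_eseriesr => n _.
by rewrite -EFinM mulrA -[in RHS]powRM ?normc_ge0// -(normcM a (f n)).
Qed.

Lemma lpbeta_sum0 : lpbeta_sum p beta 0%R = 0%E.
Proof.
by rewrite /lpbeta_sum eseries0// => n _ _; rewrite normc0 powR0 ?mul0r ?gt_eqF.
Qed.

Lemma lpbeta_sumD_lty f g :
  (lpbeta_sum p beta f < +oo)%E -> (lpbeta_sum p beta g < +oo)%E ->
  (lpbeta_sum p beta (f + g)%R < +oo)%E.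
Proof.
move=> foo goo; apply: (@lty_poweRy _ _ p^-1).
  by rewrite gt_eqF ?invr_gt0.
apply: le_lt_trans (lpbeta_minkowski _ _) _.
by rewrite lte_add_pinfty// poweR_lty.
Qed.

Lemma lpbeta_sumZ_lty (a : R[i]) f :
  (lpbeta_sum p beta f < +oo)%E -> (lpbeta_sum p beta (a *: f)%R < +oo)%E.
Proof. by move=> foo; rewrite lpbeta_sumZ lte_mul_pinfty// lee_fin powR_ge0. Qed.

Lemma ler_lpbeta_normD f g :
  (lpbeta_sum p beta f < +oo)%E -> (lpbeta_sum p beta g < +oo)%E ->
  lpbeta_norm p beta (f + g) <= lpbeta_norm p beta f + lpbeta_norm p beta g.
Proof.
move=> foo goo; have := lpbeta_minkowski f g.
rewrite (lpbeta_sumE foo) (lpbeta_sumE goo) (lpbeta_sumE (lpbeta_sumD_lty foo goo)).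
by rewrite -EFinD lee_fin.
Qed.

Lemma lpbeta_normZ (a : R[i]) f : (lpbeta_sum p beta f < +oo)%E ->
  lpbeta_norm p beta (a *: f) = normc a * lpbeta_norm p beta f.
Proof.
move=> foo; rewrite /lpbeta_norm lpbeta_sumZ fineM//; last first.
  by rewrite ge0_fin_numE ?lpbeta_sum_ge0.
rewrite powRM ?powR_ge0 ?fine_ge0 ?lpbeta_sum_ge0//.
by rewrite -powRrM mulfV ?gt_eqF// powRr1 ?normc_ge0.
Qed.

Lemma lpbeta_norm_eq0 f : (lpbeta_sum p beta f < +oo)%E ->
  lpbeta_norm p beta f = 0 -> f = 0.
Proof.
move=> foo f0; have: (lpbeta_sum p beta f `^ p^-1)%E = 0%E.
  by rewrite lpbeta_sumE// f0.
move=> /(poweR_eq0_eq0 (lpbeta_sum_ge0 f)) f00.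
apply/funext => n; apply: eq0_normc.
pose u k := (normc (f k) `^ p * beta k `^ p)%:E.
have u0 k : (0 <= u k)%E by rewrite lee_fin mulr_ge0 ?powR_ge0.
have fn0 : (\sum_(0 <= k < n.+1) u k <= 0)%E.
  by rewrite -[leRHS]f00; apply: nneseries_lim_ge => k _ _; exact: u0.
move: fn0; rewrite big_nat_recr//= => fn0.
have {fn0} : wabs f n `^ p <= 0.
  rewrite -lee_fin wabs_powR; apply: le_trans fn0.
  by rewrite leeDr// sume_ge0.
move=> fn0; have /eqP : wabs f n `^ p = 0 by apply/eqP; rewrite eq_le fn0 powR_ge0.
by rewrite powR_eq0 mulf_eq0 (gt_eqF (beta_gt0 n)) orbF => /andP[/eqP].
Qed.

End Lpbeta_norm_theory.

Section Lpbeta.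
Context {R : realType} {p : R} {beta : R^nat}.

(* The proof arguments only key the structures declared below. *)
Definition in_lpbeta (p1 : 1 <= p) (beta_gt0 : forall n, 0 < beta n) :
  {pred cseq R} := [pred f | `[< (lpbeta_sum p beta f < +oo)%E >]].

Record lpbeta (p1 : 1 <= p) (beta_gt0 : forall n, 0 < beta n) := Lpbeta {
  coeffs :> cseq R ;
  coeffsP : coeffs \in in_lpbeta p1 beta_gt0 }.

Variables (p1 : 1 <= p) (beta_gt0 : forall n, 0 < beta n).
Local Notation V := (lpbeta p1 beta_gt0).

HB.instance Definition _ := [isSub for @coeffs p1 beta_gt0].
HB.instance Definition _ := gen_eqMixin V.
HB.instance Definition _ := gen_choiceMixin V.

Lemma in_lpbeta_submod_closed : submod_closed (in_lpbeta p1 beta_gt0).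
Proof.
split; first by apply/asboolP; rewrite lpbeta_sum0// ltry.
move=> a f g /asboolP foo /asboolP goo; apply/asboolP.
exact/lpbeta_sumD_lty/goo/lpbeta_sumZ_lty.
Qed.

HB.instance Definition _ := GRing.isSubmodClosed.Build _ _
  (in_lpbeta p1 beta_gt0) in_lpbeta_submod_closed.
HB.instance Definition _ := [SubChoice_isSubLmodule of V by <:].

Lemma lpbeta_lty (f : V) : (lpbeta_sum p beta f < +oo)%E.
Proof. exact/asboolP/coeffsP. Qed.

Let norm (f : V) : R[i] := (lpbeta_norm p beta f)%:C.

Let ler_normD (f g : V) : norm (f + g) <= norm f + norm g.
Proof. by rewrite -rmorphD lecR ler_lpbeta_normD// lpbeta_lty. Qed.

Let normZ (a : R[i]) (f : V) : norm (a *: f) = `|a| * norm f.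
Proof.
rewrite /norm lpbeta_normZ// ?lpbeta_lty// rmorphM.
by case: a.
Qed.

Let norm_eq0 (f : V) : norm f = 0 -> f = 0.
Proof.
by case=> /(lpbeta_norm_eq0 beta_gt0 (lpbeta_lty f)) f0; apply/val_inj.
Qed.

HB.instance Definition _ :=
  Lmodule_isNormed.Build R[i] V ler_normD normZ norm_eq0.

Lemma lpbeta_normE (f : V) : `|f| = (lpbeta_norm p beta f)%:C.
Proof. by []. Qed.

(* ell^p_i(beta) for finite i; ell^p_oo(beta) is [set 0] *)
Definition lpbeta_tail (i : nat) : set V :=
  [set f | forall n, (n < i)%N -> f n = 0].

End Lpbeta.

Section Weighted_product.
Context {R : realType} (delta : R^nat).

(* coefficient of z^n in f <> g: the pairs (k, m) with k + m = n *)
Definition wprod (f g : cseq R) : cseq R := fun n =>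
  \sum_(k < n.+1) (delta n / (delta k * delta (n - k)%N))%:C * f k * g (n - k)%N.

Definition zseq : cseq R := fun n => (n == 1%N)%:R.

Definition Mz (f : cseq R) : cseq R := wprod zseq f.

Lemma Mz0 f : Mz f 0%N = 0.
Proof. by rewrite /Mz /wprod big_ord1 mulr0 mul0r. Qed.

Lemma MzS f n : Mz f n.+1 = (delta n.+1 / (delta n * delta 1%N))%:C * f n.
Proof.
rewrite /Mz /wprod (bigD1 (lift ord0 ord0))//= big1 ?addr0 => [|k k1].
  by rewrite /bump/= mulr1 subn1/= [delta 1%N * _]mulrC.
rewrite /zseq (_ : (k : nat) == 1%N = false) ?mulr0 ?mul0r//.
by apply: contraNF k1 => /eqP k1; apply/eqP/val_inj.
Qed.

End Weighted_product.

Section Conditions.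
Context {R : realType} (delta beta : R^nat).
Local Notation w n := (delta n * beta n).

Definition conjugate_exponent (p : R) : R := p / (p - 1).

Definition C_sup (q : R) (i : nat) : \bar R :=
  ereal_sup [set (\sum_(i <= k < n.+1)
      (w n / (delta k * delta (n - k + i)%N * beta k * beta (n - k + i)%N))
        `^ q)%:E | n in [set n | (i <= n)%N]].

Definition b_sup (i k M : nat) : \bar R :=
  ereal_sup [set (w (n + k)%N /
      (delta n * delta (k + i)%N * beta n * beta (k + i)%N))%:E
    | n in [set n | (M + i + 1 <= n)%N]].

(* used with i <= N, so that the subtraction n + m - i never truncates *)
Definition B_sum (i N : nat) : \bar R :=
  (\esum_(nm in [set nm : nat * nat | (N + 1 <= nm.1)%N /\ (N + 1 <= nm.2)%N])
    (w (nm.1 + nm.2 - i)%N /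
      (delta nm.1 * delta nm.2 * beta nm.1 * beta nm.2))%:E)%E.

End Conditions.

Section Invariant_subspaces.
Context {K : numFieldType} {V : normedModType K}.
Implicit Type T : {linear V -> V}.

Definition bounded_operator T := exists C : K, forall x, `|T x| <= C * `|x|.

Definition Lat T : set (set V) :=
  [set W | [/\ closed W, submod_closed [in W] & T @` W `<=` W]].

Definition unicellular T :=
  bounded_operator T /\
  forall W1 W2, Lat T W1 -> Lat T W2 -> W1 `<=` W2 \/ W2 `<=` W1.

End Invariant_subspaces.

(* Main.v *)
Require Import Defs.
From HB Require Import structures.
From mathcomp Require Import all_boot all_order all_algebra.
From mathcomp Require Import all_classical all_reals all_analysis.
From mathcomp Require Import complex ring lra.

Import Order.TTheory GRing.Theory Num.Theory.
Import numFieldNormedType.Exports.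
Import ComplexField.Normc.

Set Implicit Arguments.
Unset Strict Implicit.
Unset Printing Implicit Defensive.

Local Open Scope classical_set_scope.
Local Open Scope ring_scope.

(** Dividing the n-th coefficient by [delta n] turns the operator into
[(delta 1)^-1] times the unweighted shift, on the l^p space of the weight
[delta n * beta n].  The tail of index [i] then becomes the l^p space of the
translated weight [v k = delta (i + k) * beta (i + k)], on which the
conditions of index [i] say two things about the ordinary Cauchy product.

First, the product is bounded, [||f g|| <= D ||f|| ||g||]
([cprod_bounded_tail_weight]).  For [1 < p] this is Hoelder's inequality
applied to each coefficient, the sum in [C_sup] being the power [q] of the
kernel [v n / (v k * v (n - k))]; for [p = 1] it suffices that this kernel is
bounded, which [B_sum] gives for large indices and [b_sup] for small ones.
Second, by [b_sup], each positive power of the shift has arbitrarily small norm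
on the series of large enough order ([shift_vanishing_tail_weight]).

Let [f] have constant term [1] and finite norm.  Approximating [f - 1] by a
polynomial without constant term, the two facts show that multiplication by
[f - 1] is a contraction on the series of order at least some [M]
([cprod_contraction]).  Hence the formal inverse [g] of [f] has finite norm
([inverse_inlp]): its first [M] coefficients form a polynomial, and the rest [h]
solves [h = r - (f - 1) h] with [r] of finite norm.

A closed invariant subspace is stable under multiplication by all series of
finite norm, since the polynomials are dense ([embed_in_cprod]).  If it contains
an element [f] of exact order [i], normalized as above, it therefore contains
[g f = 1], hence the whole tail of index [i] ([tail_sub_Lat]).  Taking for [i]
the least order of an element of a nonzero invariant subspace identifies this
subspace with a tail. *)

(** * Weighted l^p norms *)

Section Finite_sums.
Context {R : realType}.

(** Adding one term at a time reduces the inequality to its two-term case. *)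
Lemma hoelder_sum (p q : R) (a b : R^nat) n : 0 < p -> 0 < q ->
  p^-1 + q^-1 = 1 -> (forall k, 0 <= a k) -> (forall k, 0 <= b k) ->
  \sum_(k < n) a k * b k <=
    (\sum_(k < n) a k `^ p) `^ p^-1 * (\sum_(k < n) b k `^ q) `^ q^-1.
Proof.
move=> p0 q0 pq a0 b0; elim: n => [|n IHn].
  by rewrite !big_ord0 mulr_ge0 ?powR_ge0.
have S0 (c : R^nat) (r : R) : 0 <= \sum_(k < n) c k `^ r.
  by apply: sumr_ge0 => k _; exact: powR_ge0.
rewrite !big_ord_recr/=; apply: (le_trans (lerD IHn (lexx _))).
move: (S0 a p) (S0 b q) => {S0 IHn}.
move: (\sum_(k < n) a k `^ p) (\sum_(k < n) b k `^ q) => X Y X0 Y0.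
have := hoelder2 (powR_ge0 X p^-1) (a0 n) (powR_ge0 Y q^-1) (b0 n) p0 q0 pq.
by rewrite -!powRrM !mulVf ?gt_eqF// [X `^ 1]powRr1// [Y `^ 1]powRr1.
Qed.

(** The pairs [(k, n - k)] with [n < m] form a triangle contained in the square
of side [m]. *)
Lemma sum_convolution_le (x y : R^nat) m : (forall k, 0 <= x k) ->
  (forall k, 0 <= y k) ->
  \sum_(n < m) \sum_(k < n.+1) x k * y (n - k)%N <=
    (\sum_(k < m) x k) * (\sum_(k < m) y k).
Proof.
move=> x0 y0.
elim: m => [|m IHm]; first by rewrite !big_ord0 mulr0.
have -> : \sum_(n < m.+1) \sum_(k < n.+1) x k * y (n - k)%N =
    \sum_(k < m.+1) x k * \sum_(j < (m - k).+1) y j.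
  elim: {IHm} m => [|m IHm]; first by rewrite !big_ord1/= ?big_ord1.
  rewrite big_ord_recr/= IHm.
  rewrite [in RHS]big_ord_recr/= [X in _ + X]big_ord_recr/=.
  rewrite addrA; congr (_ + _); last by rewrite subnn big_ord1.
  rewrite -big_split/=; apply: eq_bigr => k _.
  by rewrite -mulrDr (subSn (leq_ord k)) [in RHS]big_ord_recr.
rewrite mulr_suml; apply: ler_sum => k _; rewrite ler_wpM2l//.
rewrite -!(big_mkord xpredT y) [leRHS](@big_cat_nat _ _ _ (m - k).+1)//=.
  by rewrite lerDl sumr_ge0.
by rewrite ltnS leq_subr.
Qed.

End Finite_sums.

Section Weighted_lp.
Context {R : realType}.
Implicit Types (f g : cseq R) (p : R) (v u : R^nat).

Definition inlp p v f := (lpbeta_sum p v f < +oo)%E.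

Context {p : R}.
Hypothesis p1 : 1 <= p.
Let p0 : 0 < p. Proof. exact: lt_le_trans p1. Qed.

Lemma normc_real (a : R) : 0 <= a -> normc (a%:C)%C = a.
Proof. by move=> a0; rewrite /= expr0n/= addr0 sqrtr_sqr ger0_norm. Qed.

Definition wmod v f : R^nat := fun k => normc (f k) * v k.

Lemma powRpK (x : R) : 0 <= x -> (x `^ p) `^ p^-1 = x.
Proof. by move=> x0; rewrite -powRrM mulfV ?gt_eqF// powRr1. Qed.

Lemma powRVpK (x : R) : 0 <= x -> (x `^ p^-1) `^ p = x.
Proof. by move=> x0; rewrite -powRrM mulVf ?gt_eqF// powRr1. Qed.

Section one_weight.
Context {v : R^nat}.
Hypothesis v_gt0 : forall n, 0 < v n.

Lemma wmod_ge0 f n : 0 <= wmod v f n.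
Proof. by rewrite mulr_ge0 ?normc_ge0 ?ltW. Qed.

Lemma lpbeta_sum_wmod f :
  lpbeta_sum p v f = (\sum_(0 <= n <oo) (wmod v f n `^ p)%:E)%E.
Proof.
by apply: eq_eseriesr => n _; rewrite powRM ?normc_ge0 ?ltW.
Qed.

Lemma lpbeta_norm_ge0 f : 0 <= lpbeta_norm p v f.
Proof. exact: powR_ge0. Qed.

(** Finiteness and the bound on the norm are both read off the partial sums;
this is how every norm below is estimated. *)
Lemma lpbeta_norm_le f A : 0 <= A ->
  (forall n, \sum_(k < n) wmod v f k `^ p <= A `^ p) ->
  inlp p v f /\ lpbeta_norm p v f <= A.
Proof.
move=> A0 fA.
have SA : (lpbeta_sum p v f <= (A `^ p)%:E)%E.
  rewrite lpbeta_sum_wmod; apply: lime_le.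
    by apply: is_cvg_nneseries => n _ _; rewrite lee_fin powR_ge0.
  by apply: nearW => n; rewrite big_mkord sumEFin lee_fin.
have foo : inlp p v f by apply: le_lt_trans SA _; rewrite ltry.
split => //.
rewrite -[leRHS](powRpK A0) ge0_ler_powR ?invr_ge0 ?(ltW p0)// ?nnegrE.
- exact/fine_ge0/lpbeta_sum_ge0.
- exact: powR_ge0.
- by rewrite -lee_fin fineK// ge0_fin_numE// lpbeta_sum_ge0.
Qed.

Lemma lpbeta_partial_le f n : inlp p v f ->
  \sum_(k < n) wmod v f k `^ p <= lpbeta_norm p v f `^ p.
Proof.
move=> foo; rewrite powRVpK; last exact/fine_ge0/lpbeta_sum_ge0.
rewrite -lee_fin fineK; last by rewrite ge0_fin_numE// lpbeta_sum_ge0.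
rewrite lpbeta_sum_wmod -sumEFin -(big_mkord xpredT (fun k => (wmod v f k `^ p)%:E)).
by apply: nneseries_lim_ge => k _ _; rewrite lee_fin powR_ge0.
Qed.

Lemma normc_le_lpbeta f n : inlp p v f -> normc (f n) * v n <= lpbeta_norm p v f.
Proof.
move=> foo; rewrite -[leLHS]/(wmod v f n).
rewrite -[leLHS](powRpK (wmod_ge0 _ _)) -[leRHS](powRpK (lpbeta_norm_ge0 _)).
rewrite ge0_ler_powR ?invr_ge0 ?(ltW p0) ?nnegrE ?powR_ge0//.
apply: le_trans (lpbeta_partial_le n.+1 foo).
by rewrite big_ord_recr/= lerDr sumr_ge0// => k _; rewrite powR_ge0.
Qed.

Definition ztrunc n f : cseq R := fun k => if (k < n)%N then f k else 0.

Lemma ztrunc_inlp n f : inlp p v (ztrunc n f).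
Proof.
rewrite /inlp lpbeta_sum_wmod (nneseries_split 0 n); last first.
  by move=> k _; rewrite lee_fin powR_ge0.
rewrite ereal_series_cond eseries0 ?adde0; last first.
  move=> k; rewrite add0n => _ /andP[nk _].
  by rewrite /wmod /ztrunc (leq_gtF nk) normc0 mul0r powR0 ?gt_eqF.
by rewrite sumEFin ltry.
Qed.

Lemma ztrunc_approx f e : inlp p v f -> 0 < e ->
  exists n, lpbeta_norm p v (f - ztrunc n f) <= e.
Proof.
move=> foo e0.
have tail0 : (\sum_(n <= k <oo) (wmod v f k `^ p)%:E)%E @[n --> \oo] --> 0%E.
  apply: nneseries_tail_cvg => [|k _]; last by rewrite lee_fin powR_ge0.
  by rewrite -lpbeta_sum_wmod.
have e1 : (0%E < (e `^ p)%:E)%E by rewrite lte_fin powR_gt0.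
have [n _ nP] := tail0 _ (open_ereal_lt' e1).
exists n; have {}nP := nP n (leqnn n).
pose d := f - ztrunc n f.
(* the difference vanishes before [n], so its sum is at most the tail from [n] *)
have dE k : d k = f k - ztrunc n f k by [].
have d0 k : (k < n)%N -> wmod v d k = 0.
  by move=> kn; rewrite /wmod dE /ztrunc kn subrr normc0 mul0r.
have d1 k : wmod v d k `^ p <= wmod v f k `^ p.
  have [kn|nk] := ltnP k n; first by rewrite d0// powR0 ?gt_eqF// powR_ge0.
  by rewrite {1}/wmod dE /ztrunc (leq_gtF nk) subr0.
have dS : (lpbeta_sum p v d <= (e `^ p)%:E)%E.
  rewrite lpbeta_sum_wmod (nneseries_split 0 n); last first.
    by move=> k _; rewrite lee_fin powR_ge0.
  rewrite add0n big1_seq ?add0e; last first.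
    by move=> k /andP[_]; rewrite mem_index_iota => /= kn; rewrite d0// powR0 ?gt_eqF.
  apply: le_trans (ltW nP).
  by apply: lee_nneseries => k *; rewrite lee_fin ?powR_ge0.
suff dm m : \sum_(k < m) wmod v d k `^ p <= e `^ p.
  by have [_] := lpbeta_norm_le (ltW e0) dm.
rewrite -lee_fin; apply: le_trans dS.
rewrite lpbeta_sum_wmod -sumEFin -(big_mkord xpredT (fun k => (wmod v d k `^ p)%:E)).
by apply: nneseries_lim_ge => k _ _; rewrite lee_fin powR_ge0.
Qed.

End one_weight.

(** Comparison of two weights along an index shift: it yields at once the
monotonicity of the norm ([j = 0], [u = v]), the norm of the powers of the
shift ([u = v]), and the identification of a tail of one space with another
space. *)
Lemma lpbeta_norm_shift v u f g j c : (forall n, 0 < v n) ->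
  (forall n, 0 < u n) -> 0 <= c -> (forall n, (n < j)%N -> f n = 0) ->
  (forall n, wmod v f (n + j)%N <= c * wmod u g n) -> inlp p u g ->
  inlp p v f /\ lpbeta_norm p v f <= c * lpbeta_norm p u g.
Proof.
move=> v0 u0 c0 fj fg goo; apply: lpbeta_norm_le => //.
  by rewrite mulr_ge0 ?lpbeta_norm_ge0.
move=> n; rewrite powRM ?lpbeta_norm_ge0//.
apply: le_trans (ler_wpM2l (powR_ge0 c p) (lpbeta_partial_le u0 n goo)).
rewrite mulr_sumr.
have -> : \sum_(k < n) wmod v f k `^ p =
          \sum_(k < n - j) wmod v f (k + j)%N `^ p.
  rewrite -(big_mkord xpredT (fun k => wmod v f k `^ p)).
  rewrite -(big_mkord xpredT (fun k => wmod v f (k + j)%N `^ p)).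
  have [nj|jn] := leqP n j.
    have -> : (n - j = 0)%N by apply/eqP; rewrite subn_eq0.
    rewrite [RHS]big_geq// big1_seq// => k /andP[_].
    rewrite mem_index_iota => /andP[_ kn].
    by rewrite /wmod fj ?normc0 ?mul0r ?powR0 ?gt_eqF// (leq_trans kn).
  rewrite (@big_cat_nat _ _ _ j)//= ?(ltnW jn)// big1_seq ?add0r; last first.
    move=> k /andP[_]; rewrite mem_index_iota => /andP[_ kn].
    by rewrite /wmod fj ?normc0 ?mul0r ?powR0 ?gt_eqF.
  by rewrite -{1}(add0n j) big_addn.
rewrite -!(big_mkord xpredT (fun k => c `^ p * wmod u g k `^ p)).
rewrite [leRHS](@big_cat_nat _ _ _ (n - j))//= ?leq_subr//.
rewrite big_mkord -[leLHS]addr0 lerD//; last first.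
  by apply: sumr_ge0 => k _; rewrite mulr_ge0// powR_ge0.
apply: ler_sum => k _; rewrite -powRM ?wmod_ge0//.
by rewrite ge0_ler_powR ?(ltW p0) ?nnegrE ?(mulr_ge0 c0) ?(wmod_ge0 v0) ?(wmod_ge0 u0).
Qed.

End Weighted_lp.

(** * The Cauchy product *)

Section Cauchy_product.
Context {R : realType}.
Implicit Types f g h : cseq R.

Definition cprod f g : cseq R := fun n => \sum_(k < n.+1) f k * g (n - k)%N.

Definition zshift j f : cseq R := fun n => if (n < j)%N then 0 else f (n - j)%N.

Definition cprod1 : cseq R := fun n => (n == 0%N)%:R.

Lemma cprodC f g : cprod f g = cprod g f.
Proof.
apply/funext => n; rewrite /cprod (reindex_inj rev_ord_inj)/=.
by apply: eq_bigr => k _; rewrite subSS subKn ?leq_ord// mulrC.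
Qed.

Lemma cprodDl f g h : cprod (f + g) h = cprod f h + cprod g h.
Proof.
apply/funext => n; rewrite [LHS]/cprod.
under eq_bigr do rewrite [X in X * _]/(f _ + g _) mulrDl.
exact: big_split.
Qed.

Lemma cprodBl f g h : cprod (f - g) h = cprod f h - cprod g h.
Proof. by apply/eqP; rewrite eq_sym subr_eq -cprodDl subrK. Qed.

Lemma cprodBr f g h : cprod f (g - h) = cprod f g - cprod f h.
Proof. by rewrite cprodC cprodBl !(cprodC f). Qed.

Lemma cprod1l f : cprod cprod1 f = f.
Proof.
apply/funext => n; rewrite /cprod big_ord_recl/= mul1r subn0 big1 ?addr0//.
by move=> k _; rewrite mul0r.
Qed.

Lemma ztrunc0 f : ztrunc 0 f = 0.
Proof. by apply/funext. Qed.

(** A product by a polynomial is a combination of shifts. *)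
Lemma cprod_ztruncS n f g :
  cprod (ztrunc n.+1 f) g = cprod (ztrunc n f) g + f n *: zshift n g.
Proof.
apply/funext => m.
rewrite [RHS](_ : _ =
  GRing.add (cprod (ztrunc n f) g m : R[i]) (GRing.mul (f n : R[i]) (zshift n g m)))//.
rewrite /cprod /zshift; case: ltnP => [mn|nm].
  rewrite mulr0 addr0; apply: eq_bigr => k _; rewrite /ztrunc.
  have kn : (k < n)%N by apply: leq_ltn_trans mn; exact: leq_ord.
  by rewrite kn (ltn_trans kn).
have nm1 : (n < m.+1)%N by [].
rewrite (bigD1 (Ordinal nm1))//= [in RHS](bigD1 (Ordinal nm1))//=.
rewrite {1 3}/ztrunc ltnSn ltnn mul0r add0r addrC; congr (_ + _).
apply: eq_bigr => k kn; rewrite /ztrunc ltnS leq_eqVlt.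
by have -> : (k : nat) == n = false by apply: contraNF kn => /eqP kn; apply/eqP/val_inj.
Qed.

(** A power series with constant term [1] is formally invertible; the
coefficients of the inverse are computed by course-of-values recursion, hence
through the list of those already known. *)
Lemma cprod_inverse f : f 0%N = 1 -> exists g, cprod f g = cprod1.
Proof.
move=> f0.
pose step (s : seq R[i]) : R[i] :=
  cprod1 (size s) - \sum_(k < size s) f k.+1 * s`_(size s - k.+1).
pose s := fix s n := if n is m.+1 then rcons (s m) (step (s m)) else [::].
have sizes n : size (s n) = n by elim: n => //= n IHn; rewrite size_rcons IHn.
have sS n k : (k < n)%N -> (s n)`_k = step (s k).
  elim: n => // n IHn; rewrite ltnS leq_eqVlt => /predU1P[->|kn] /=.
    by rewrite nth_rcons sizes ltnn eqxx.
  by rewrite nth_rcons sizes kn IHn.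
exists (fun n => step (s n)); apply/funext => n.
rewrite /cprod big_ord_recl/= f0 mul1r subn0 {1}/step sizes.
rewrite -[RHS](subrK (\sum_(k < n) f k.+1 * (s n)`_(n - k.+1))).
congr (_ + _); apply: eq_bigr => k _; rewrite sS// ltn_subrL/=.
by case: n k => [[]|].
Qed.

Lemma normc_sum_le (h : nat -> R[i]) n :
  normc (\sum_(k < n) h k) <= \sum_(k < n) normc (h k).
Proof.
elim: n => [|n IHn]; first by rewrite !big_ord0 normc0.
by rewrite !big_ord_recr/=; apply: le_trans (le_normcD _ _) _; rewrite lerD2r.
Qed.

End Cauchy_product.

Section Bounded_product_def.
Context {R : realType}.

(** The norm of the monomial of degree [n] over the product of the norms of those
of degrees [k] and [n - k]. *)
Definition cprod_ker (v : R^nat) (n k : nat) : R := v n / (v k * v (n - k)%N).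

Definition cprod_bounded p v D := forall f g : cseq R, inlp p v f -> inlp p v g ->
  inlp p v (cprod f g) /\
  lpbeta_norm p v (cprod f g) <= D * lpbeta_norm p v f * lpbeta_norm p v g.

(** The estimate of a single coefficient of a product, in a form that follows
either from Hoelder's inequality or from a uniform bound on the kernel. *)
Definition kernel_bounded p v D := forall n (x : R^nat), (forall k, 0 <= x k) ->
  (\sum_(k < n.+1) cprod_ker v n k * x k) `^ p <=
    D `^ p * \sum_(k < n.+1) x k `^ p.

End Bounded_product_def.

Section Bounded_product.
Context {R : realType} {p : R} {v : R^nat}.
Hypotheses (p1 : 1 <= p) (v_gt0 : forall n, 0 < v n).
Implicit Types f g h : cseq R.

Let p0 : 0 < p. Proof. exact: lt_le_trans p1. Qed.
Local Notation N := (lpbeta_norm p v).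
Local Notation fin := (inlp p v).

Lemma cprod_ker_ge0 n k : 0 <= cprod_ker v n k.
Proof. by rewrite divr_ge0 ?mulr_ge0 ?ltW. Qed.

(** The coefficientwise bound sums up because the powers [p] of the weighted
moduli are again convolved, and the l^1 norm is submultiplicative. *)
Lemma kernel_cprod_bounded D : 0 <= D -> kernel_bounded p v D -> cprod_bounded p v D.
Proof.
move=> D0 kD f g foo goo.
have cge0 (h : cseq R) k : 0 <= wmod v h k by exact: wmod_ge0.
have N0 (h : cseq R) : 0 <= N h by exact: lpbeta_norm_ge0.
apply: lpbeta_norm_le => //; first by rewrite !mulr_ge0.
move=> m; rewrite !powRM ?mulr_ge0//.
have le1 n : wmod v (cprod f g) n `^ p <=
    D `^ p * \sum_(k < n.+1) wmod v f k `^ p * wmod v g (n - k)%N `^ p.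
  under eq_bigr do rewrite -powRM//.
  apply: le_trans (kD n (fun k => wmod v f k * wmod v g (n - k)%N) _); last first.
    by move=> k; rewrite mulr_ge0.
  rewrite ge0_ler_powR ?(ltW p0) ?nnegrE//.
    apply: sumr_ge0 => k _; apply: mulr_ge0; last exact: mulr_ge0.
    exact: cprod_ker_ge0.
  rewrite /wmod /cprod.
  apply: le_trans (ler_wpM2r (ltW (v_gt0 n)) (normc_sum_le (fun k => f k * g (n - k)%N) _)) _.
  rewrite mulr_suml; apply: ler_sum => k _; rewrite normcM /cprod_ker.
  rewrite le_eqVlt; apply/orP; left; apply/eqP.
  have := gt_eqF (v_gt0 k); have := gt_eqF (v_gt0 (n - k)%N) => /negbT h1 /negbT h2.
  by field; rewrite h1.
apply: le_trans (ler_sum _ (fun (n : 'I_m) _ => le1 n)) _.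
rewrite -mulr_sumr -mulrA ler_wpM2l ?powR_ge0//.
apply: le_trans (@sum_convolution_le _ (fun k => wmod v f k `^ p)
  (fun k => wmod v g k `^ p) m _ _) _ => [k|k|]; rewrite ?powR_ge0//.
by apply: ler_pM; rewrite ?lpbeta_partial_le// sumr_ge0// => k _; rewrite powR_ge0.
Qed.

Lemma kernel_bounded1 D : p = 1 -> (forall n k, (k <= n)%N -> cprod_ker v n k <= D) ->
  kernel_bounded p v D.
Proof.
move=> p_1 kD n x x0; rewrite p_1.
have D0 : 0 <= D by exact: le_trans (cprod_ker_ge0 0 0) (kD 0%N 0%N _).
rewrite !powRr1 ?sumr_ge0// => [|k _]; last by rewrite mulr_ge0 ?cprod_ker_ge0.
rewrite [X in _ <= _ * X](eq_bigr (fun k : 'I_n.+1 => x k)); last first.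
  by move=> k _; rewrite powRr1.
rewrite mulr_sumr; apply: ler_sum => k _; rewrite ler_wpM2r// kD//.
exact: leq_ord.
Qed.

Lemma kernel_bounded_hoelder q C : 0 < q -> p^-1 + q^-1 = 1 ->
  (forall n, \sum_(k < n.+1) cprod_ker v n k `^ q <= C) ->
  kernel_bounded p v (C `^ q^-1).
Proof.
move=> q0 pq kC n x x0.
have C0 : 0 <= C by apply: le_trans (kC 0%N); rewrite sumr_ge0// => k _; rewrite powR_ge0.
have S0 : 0 <= \sum_(k < n.+1) x k `^ p by rewrite sumr_ge0// => k _; rewrite powR_ge0.
have qp : q^-1 + p^-1 = 1 by rewrite addrC.
rewrite -[X in _ <= _ * X](powRVpK p1 S0) -powRM ?powR_ge0//.
rewrite ge0_ler_powR ?(ltW p0) ?nnegrE ?mulr_ge0 ?powR_ge0//.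
  by apply: sumr_ge0 => k _; rewrite mulr_ge0 ?cprod_ker_ge0.
apply: le_trans (hoelder_sum n.+1 q0 p0 qp (cprod_ker_ge0 n) x0) _.
rewrite ler_wpM2r ?powR_ge0// ge0_ler_powR ?invr_ge0 ?(ltW q0) ?nnegrE//.
by rewrite sumr_ge0// => k _; rewrite powR_ge0.
Qed.

End Bounded_product.

(** * Inversion of power series of finite norm *)

Lemma le2_of_half {R : realFieldType} (a b : R) : a <= b + 2^-1 * a -> a <= 2 * b.
Proof. by lra. Qed.

(** Every positive power of the shift has norm tending to [0] on the subspaces
of series of order at least [M], as [M] grows. *)
Definition shift_vanishing {R : realType} (v : R^nat) :=
  forall k, (0 < k)%N -> forall e, 0 < e ->
    exists M, forall n, (M <= n)%N -> v (n + k)%N <= e * v n.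

Section Inverse.
Context {R : realType} {p : R} {v : R^nat}.
Hypotheses (p1 : 1 <= p) (v_gt0 : forall n, 0 < v n).
Implicit Types f g h : cseq R.

Local Notation N := (lpbeta_norm p v).
Local Notation fin := (inlp p v).

Lemma lpbeta_norm_dom f g : (forall n, wmod v f n <= wmod v g n) ->
  fin g -> fin f /\ N f <= N g.
Proof.
move=> fg goo; rewrite -[N g]mul1r.
by apply: (@lpbeta_norm_shift _ _ p1 _ _ _ _ 0) => // n; rewrite addn0 mul1r.
Qed.

Lemma lpbeta_normN f : fin f -> fin (- f) /\ N (- f) <= N f.
Proof.
move=> foo; apply: lpbeta_norm_dom => // n.
by rewrite /wmod [X in X * _](normcN (f n)).
Qed.

Lemma lpbeta_normB f g : fin f -> fin g ->
  fin (f - g) /\ N (f - g) <= N f + N g.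
Proof.
move=> foo /lpbeta_normN[goo gN]; split; first exact: (lpbeta_sumD_lty p1 v_gt0).
apply: le_trans (ler_lpbeta_normD p1 v_gt0 foo goo) _.
by rewrite lerD2l.
Qed.

Lemma lpbeta_norm0 : N 0 = 0.
Proof.
by rewrite /lpbeta_norm lpbeta_sum0//= powR0// invr_eq0 gt_eqF// (lt_le_trans _ p1).
Qed.

Variable D : R.
Hypotheses (D0 : 0 <= D) (vD : cprod_bounded p v D).

Hypothesis vS : shift_vanishing v.

(** A polynomial without constant term is a finite sum of positive powers of the
shift, each of which is small on the series of large order. *)
Lemma cprod_ztrunc_small f K e : f 0%N = 0 -> 0 < e ->
  exists M, forall g, fin g -> (forall k, (k < M)%N -> g k = 0) ->
    fin (cprod (ztrunc K f) g) /\ N (cprod (ztrunc K f) g) <= e * N g.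
Proof.
move=> f0; elim: K e => [|K IHK] e e0.
  exists 0%N => g goo _; rewrite ztrunc0.
  have -> : cprod 0 g = 0 by rewrite -{1}(subrr g) cprodBl subrr.
  rewrite lpbeta_norm0 mulr_ge0 ?(ltW e0) ?lpbeta_norm_ge0//.
  by rewrite /inlp lpbeta_sum0// (lt_le_trans _ p1).
have e2 : 0 < e / 2 by rewrite divr_gt0.
have [M1 M1P] := IHK _ e2.
have [M2 M2P] : exists M, forall g, fin g -> (forall k, (k < M)%N -> g k = 0) ->
    fin (f K *: zshift K g) /\ N (f K *: zshift K g) <= e / 2 * N g.
  have [M MP] : exists M, forall n, (M <= n)%N ->
      normc (f K) * v (n + K)%N <= e / 2 * v n.
    have [->|K0] := posnP K.
      by exists 0%N => n _; rewrite f0 normc0 mul0r mulr_ge0 ?ltW.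
    (* the coefficient may vanish, hence the added one in the denominator *)
    have fK0 : 0 < normc (f K) + 1 by rewrite ltr_wpDl ?normc_ge0.
    have [M MP] := vS K0 (divr_gt0 e2 fK0).
    exists M => n Mn; apply: le_trans (ler_wpM2l (normc_ge0 _) (MP n Mn)) _.
    rewrite mulrA ler_wpM2r ?(ltW (v_gt0 n))// mulrCA ler_piMr ?(ltW e2)//.
    by rewrite ler_pdivrMr// mul1r lerDl.
  exists M => g goo gM; apply: (lpbeta_norm_shift p1 (j := K)) => //.
  - exact: ltW.
  - by move=> n nK; rewrite [LHS]/(f K * zshift K g n) /zshift nK; exact: mulr0.
  move=> n; rewrite {1}/wmod [X in normc X]/(f K * zshift K g (n + K)%N).
  rewrite /zshift ltnNge leq_addl/= addnK normcM /wmod.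
  have [nM|Mn] := ltnP n M; first by rewrite gM// normc0 !(mulr0, mul0r).
  by rewrite mulrAC mulrCA [leLHS]mulrC ler_wpM2l ?normc_ge0// MP.
exists (maxn M1 M2) => g goo gM.
have gM1 k : (k < M1)%N -> g k = 0 by move=> kM; rewrite gM// leq_max kM.
have gM2 k : (k < M2)%N -> g k = 0 by move=> kM; rewrite gM// leq_max kM orbT.
have [a1 a2] := M1P g goo gM1; have [b1 b2] := M2P g goo gM2.
rewrite cprod_ztruncS; split; first exact: (lpbeta_sumD_lty p1 v_gt0).
apply: le_trans (ler_lpbeta_normD p1 v_gt0 a1 b1) _.
by apply: le_trans (lerD a2 b2) _; rewrite -mulrDl -splitr.
Qed.

(** Multiplication by [f], when [f] has no constant term, contracts the series
of large enough order. *)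
Lemma cprod_contraction f : fin f -> f 0%N = 0 ->
  exists M, forall g, fin g -> (forall k, (k < M)%N -> g k = 0) ->
    N (cprod f g) <= 2^-1 * N g.
Proof.
move=> foo f0.
(* half of the bound is spent on the polynomial part and half on the rest,
   whose multiplier norm is at most [D] times its norm; [D] may be zero *)
have D4 : 0 < (4 * (D + 1))^-1 :> R by rewrite invr_gt0 mulr_gt0// ltr_wpDl.
have [K fK] := ztrunc_approx p1 v_gt0 foo D4.
have [M MP] : exists M, forall g, fin g -> (forall k, (k < M)%N -> g k = 0) ->
    fin (cprod (ztrunc K f) g) /\ N (cprod (ztrunc K f) g) <= 4^-1 * N g.
  by apply: cprod_ztrunc_small => //; rewrite invr_gt0.
exists M => g goo gM; have [a1 a2] := MP g goo gM.
have [doo _] := lpbeta_normB foo (ztrunc_inlp p1 v_gt0 K f).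
have [b1 b2] := vD doo goo.
have -> : cprod f g = cprod (f - ztrunc K f) g + cprod (ztrunc K f) g.
  by rewrite -cprodDl subrK.
apply: le_trans (ler_lpbeta_normD p1 v_gt0 b1 a1) _.
have -> : 2^-1 * N g = 4^-1 * N g + 4^-1 * N g by rewrite -mulrDl; congr (_ * _); field.
apply: lerD a2; apply: le_trans b2 _; rewrite ler_wpM2r ?lpbeta_norm_ge0//.
apply: le_trans (ler_wpM2l D0 fK) _.
rewrite invfM mulrCA ler_piMr ?invr_ge0//.
by rewrite ler_pdivrMr ?mul1r ?lerDl// ltr_wpDl.
Qed.

(** The formal inverse has finite norm.  Its part of large order solves
[h + n h = r] with [n] contracting, and multiplication being causal the
truncations of [h] satisfy the same inequality [||h|| <= ||r|| + ||h|| / 2] as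
[h] itself, but with all terms known to be finite. *)
Lemma inverse_inlp f g : fin f -> f 0%N = 1 -> cprod f g = cprod1 -> fin g.
Proof.
move=> foo f0 fg.
have onefin : fin cprod1.
  have -> : @cprod1 R = ztrunc 1 cprod1 by apply/funext => -[].
  exact: ztrunc_inlp.
pose n := f - cprod1.
have [noo _] := lpbeta_normB foo onefin.
have n0 : n 0%N = 0.
  have c1 : cprod1 0%N = f 0%N by rewrite f0 /cprod1 eqxx.
  by rewrite [LHS]/(f 0%N - cprod1 0%N) c1; exact: subrr.
have [M MP] := cprod_contraction noo n0.
pose h := g - ztrunc M g.
have hM k : (k < M)%N -> h k = 0.
  by move=> kM; rewrite [LHS]/(g k - ztrunc M g k) /ztrunc kM; exact: subrr.
pose r := cprod1 - cprod f (ztrunc M g).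
have [goo _] := vD foo (ztrunc_inlp p1 v_gt0 M g).
have [roo _] := lpbeta_normB onefin goo.
have hE : h = r - cprod n h.
  by rewrite /n cprodBl cprod1l opprB /r /h -fg -cprodBr addrA addrAC subrr add0r.
(* causality: the coefficients of [n h] of index below [m] only involve those
   of [h] *)
have hT m k : (k < m)%N -> h k = (r - cprod n (ztrunc m h)) k.
  move=> km; rewrite {1}hE [LHS]/(r k - cprod n h k).
  rewrite [RHS]/(r k - cprod n (ztrunc m h) k); congr (_ - _).
  apply: eq_bigr => j _; rewrite /ztrunc ifT//.
  by apply: leq_ltn_trans km; exact: leq_subr.
have hN m : N (ztrunc m h) <= 2 * N r.
  have tfin := ztrunc_inlp p1 v_gt0 m h.
  have cfin : fin (cprod n (ztrunc m h)) by have [] := vD noo tfin.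
  have [dfin dle] := lpbeta_normB roo cfin.
  have tdom k : wmod v (ztrunc m h) k <= wmod v (r - cprod n (ztrunc m h)) k.
    rewrite {1}/wmod {1}/ztrunc; case: ifPn => km; last first.
      by rewrite normc0 mul0r wmod_ge0.
    by rewrite (hT _ _ km).
  have tM k : (k < M)%N -> ztrunc m h k = 0.
    by move=> kM; rewrite /ztrunc hM//; case: ifP.
  have cle := MP _ tfin tM; have [_ tle] := lpbeta_norm_dom tdom dfin.
  by apply: le2_of_half; apply: le_trans tle (le_trans dle _); rewrite lerD2l.
have [hoo _] : fin h /\ N h <= 2 * N r.
  apply: lpbeta_norm_le => //; first by rewrite mulr_ge0 ?lpbeta_norm_ge0.
  move=> m; have p0 : 0 <= p by exact: le_trans p1.
  apply: le_trans (_ : N (ztrunc m h) `^ p <= _); last first.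
    by rewrite ge0_ler_powR ?nnegrE ?mulr_ge0 ?lpbeta_norm_ge0.
  apply: le_trans (lpbeta_partial_le p1 v_gt0 m (ztrunc_inlp p1 v_gt0 m h)).
  by apply: ler_sum => k _; rewrite /wmod /ztrunc ltn_ord.
by rewrite -(subrK (ztrunc M g) g); exact/(lpbeta_sumD_lty p1 v_gt0)/ztrunc_inlp.
Qed.

End Inverse.

(** * Consequences of the conditions on the weights *)

Section Conditions_to_weights.
Context {R : realType}.

Lemma bounded_from_tail (a : R^nat) M c : (forall n, (M <= n)%N -> a n <= c) ->
  exists2 C, 0 <= C & forall n, a n <= C.
Proof.
move=> aM; exists (Num.max 0 (Num.max c (\big[Num.max/0]_(k < M) a k))).
  by rewrite le_max lexx.
move=> n; rewrite !le_max; have [nM|Mn] := ltnP n M; last by rewrite aM// orbT.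
by rewrite (le_bigmax _ (fun k : 'I_M => a k) (Ordinal nM)) !orbT.
Qed.

Lemma shift_bounded (v : R^nat) : (forall n, 0 < v n) -> shift_vanishing v ->
  forall k, exists2 C, 0 <= C & forall n, v (n + k)%N <= C * v n.
Proof.
move=> v0 vS [|k]; first by exists 1 => // n; rewrite addn0 mul1r.
have [M MP] := vS k.+1 isT 1 ltr01.
have [n Mn|C C0 CP] := @bounded_from_tail (fun n => v (n + k.+1)%N / v n) M 1.
  by rewrite ler_pdivrMr// MP.
by exists C => // n; rewrite -ler_pdivrMr.
Qed.

Context {delta beta : R^nat}.
Hypotheses (beta_gt0 : forall n, 0 < beta n) (delta_gt0 : forall n, 0 < delta n).

(** The weight for which the tail of index [i] is an l^p space of power series
starting at degree [0]. *)
Definition tail_weight i : R^nat := fun k => delta (i + k)%N * beta (i + k)%N.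
Local Notation v := tail_weight.

Lemma tail_weight_gt0 i n : 0 < v i n.
Proof. by rewrite mulr_gt0. Qed.

(** Up to the constant factor [v k], the quotient in [b_sup] is [v (n + k) / v n]
for the translated weight. *)
Lemma shift_vanishing_tail_weight i :
  (forall k, (1 <= k)%N -> b_sup delta beta i k M @[M --> \oo] --> 0%E) ->
  shift_vanishing (v i).
Proof.
move=> hb k k0 e e0.
have ev0 : (0%E < (e / v i k)%:E)%E by rewrite lte_fin divr_gt0 ?tail_weight_gt0.
have [M _ MP] := hb k k0 _ (open_ereal_lt' ev0).
exists M.+1 => n Mn.
suff : v i (n + k)%N / (v i n * v i k) <= e / v i k.
  rewrite invfM mulrA ler_pM2r ?invr_gt0 ?tail_weight_gt0//.
  by rewrite ler_pdivrMr ?tail_weight_gt0.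
rewrite -lee_fin; apply: le_trans (ltW (MP M (leqnn M))).
apply: ereal_sup_ubound; exists (i + n)%N.
  by rewrite /= addn1 (addnC M) -addnS leq_add2l.
rewrite /v addnA [(k + i)%N]addnC; congr ((_ / _)%:E); ring.
Qed.

Lemma cprod_ker_sum_le q i : (C_sup delta beta q i < +oo)%E ->
  exists C, forall n, \sum_(k < n.+1) cprod_ker (v i) n k `^ q <= C.
Proof.
move=> Coo; exists (fine (C_sup delta beta q i)) => n.
have le1 : ((\sum_(k < n.+1) cprod_ker (v i) n k `^ q)%:E <=
            C_sup delta beta q i)%E.
  apply: ereal_sup_ubound; exists (i + n)%N; first by rewrite /= leq_addr.
  congr (_%:E); rewrite -addnS.
  have reidx (F : R^nat) : \sum_(i <= k < i + n.+1) F k = \sum_(k < n.+1) F (k + i)%N.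
    by rewrite -{1}(add0n i) big_addn addKn big_mkord.
  rewrite reidx.
  apply: eq_bigr => k _; rewrite /cprod_ker /v.
  rewrite (addnC k i) subnDl [(n - k + i)%N]addnC; congr ((_ / _) `^ q); ring.
rewrite -lee_fin fineK// fin_real// Coo andbT; apply: lt_le_trans le1.
exact: ltNyr.
Qed.

(** The kernel is a symmetric function of the pair [(k, n - k)].  When both
entries exceed [N] its value is a single term of [B_sum]; when one of them is at
most [N] there are finitely many powers of the shift to bound. *)
Lemma cprod_ker_le i : shift_vanishing (v i) ->
  (exists N, [/\ (0 < N)%N, (i <= N)%N & (B_sum delta beta i N < +oo)%E]) ->
  exists C, forall n k, (k <= n)%N -> cprod_ker (v i) n k <= C.
Proof.
move=> vS [N [_ iN Boo]].
pose ker a b := v i (a + b)%N / (v i a * v i b).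
have kerC a b : ker a b = ker b a by rewrite /ker addnC [v i a * _]mulrC.
suff [C CP] : exists C, forall a b, ker a b <= C.
  exists C => n k kn; rewrite /cprod_ker -{1}(subnKC kn); exact: CP.
have farP a b : (N < a)%N -> (N < b)%N -> ker a b <= fine (B_sum delta beta i N).
  move=> Na Nb.
  have le1 : ((ker a b)%:E <= B_sum delta beta i N)%E.
    apply: esum_ge; exists [set ((i + a)%N, (i + b)%N)].
      split; first exact: finite_set1.
      move=> _ -> /=; split; rewrite addn1.
        exact: leq_trans Na (leq_addl _ _).
      exact: leq_trans Nb (leq_addl _ _).
    rewrite fsbig_set1/= lee_fin le_eqVlt; apply/orP; left; apply/eqP.
    rewrite /ker /v -addnA addKn addnCA; congr (_ / _); ring.
  rewrite -lee_fin fineK// fin_real// Boo andbT; apply: lt_le_trans le1.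
  exact: ltNyr.
have nearP a : exists2 C, 0 <= C & forall b, ker a b <= C.
  have [C C0 CP] := shift_bounded (tail_weight_gt0 i) vS a.
  exists (C / v i a) => [|b]; first by rewrite divr_ge0// ltW ?tail_weight_gt0.
  rewrite kerC /ker invfM mulrA ler_pM2r ?invr_gt0 ?tail_weight_gt0//.
  by rewrite ler_pdivrMr ?tail_weight_gt0.
have [C C0 CP] : exists2 C, 0 <= C & forall a b, (a <= N)%N -> ker a b <= C.
  elim: (N) => [|n [C C0 CP]].
    by have [C C0 CP] := nearP 0%N; exists C => // -[].
  have [C' C'0 C'P] := nearP n.+1.
  exists (C + C') => [|a b]; first by rewrite addr_ge0.
  rewrite leq_eqVlt => /predU1P[->|an].
    by apply: le_trans (C'P b) _; rewrite lerDr.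
  by apply: le_trans (CP a b an) _; rewrite lerDl.
exists (C + `|fine (B_sum delta beta i N)|) => a b.
have CC x : x <= C -> x <= C + `|fine (B_sum delta beta i N)|.
  by move=> /le_trans; apply; rewrite lerDl.
have [aN|Na] := leqP a N; first exact/CC/CP.
have [bN|Nb] := leqP b N; first by rewrite kerC; exact/CC/CP.
apply: le_trans (farP a b Na Nb) _.
by apply: le_trans (ler_norm _) _; rewrite lerDr.
Qed.

Lemma cprod_bounded_tail_weight p i : 1 <= p ->
  (1 < p -> (C_sup delta beta (conjugate_exponent p) i < +oo)%E) ->
  (p = 1 -> exists N : nat,
      [/\ (0 < N)%N, (i <= N)%N & (B_sum delta beta i N < +oo)%E]) ->
  shift_vanishing (v i) ->
  exists2 D, 0 <= D & cprod_bounded p (v i) D.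
Proof.
move=> p1 hC hB vS; have v0 := tail_weight_gt0 i.
have [p1E|pn1] := eqVneq p 1.
  have [C CP] := cprod_ker_le vS (hB p1E).
  have C0 : 0 <= C by apply: le_trans (CP 0%N 0%N _); rewrite ?cprod_ker_ge0.
  by exists C => //; apply: kernel_cprod_bounded => //; exact: kernel_bounded1.
have {pn1}p_gt1 : 1 < p by rewrite lt_neqAle eq_sym pn1.
have p0 : 0 < p by exact: lt_trans p_gt1.
have [C CP] := cprod_ker_sum_le (hC p_gt1).
exists (C `^ (conjugate_exponent p)^-1); first exact: powR_ge0.
apply: kernel_cprod_bounded; rewrite ?powR_ge0//.
apply: kernel_bounded_hoelder => //.
  by rewrite divr_gt0// subr_gt0.
by rewrite /conjugate_exponent invf_div; field; rewrite gt_eqF.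
Qed.

End Conditions_to_weights.

(** * The operator *)

Section Operator.
Context {R : realType} {p : R} {beta : R^nat}.
Variables (p1 : 1 <= p) (beta_gt0 : forall n, 0 < beta n).
Local Notation V := (lpbeta p1 beta_gt0).
Local Notation N := (lpbeta_norm p beta).

(** The norm takes its values in the complex numbers, and a positive complex
number is real: closure can be tested with real radii. *)
Lemma lpbeta_closure (A : set V) (y : V) :
  closure A y <-> forall e : R, 0 < e -> exists2 x, A x & N (y - x) < e.
Proof.
split=> [Ay e e0|Ay B /nbhs_ballP[e /= e0 eB]].
  have e0C : 0 < (e%:C)%C :> R[i] by rewrite ltcR.
  have [x [Ax]] := Ay _ (nbhsx_ballx y _ e0C).
  by rewrite -ball_normE /= lpbeta_normE ltcR => yx; exists x.
case: e e0 eB => a b; rewrite ltcE /= => /andP[/eqP b0 a0]; have {b0}-> : b = 0 by []; move=> eB.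
have [x Ax yx] := Ay _ a0.
exists x; split => //; apply: eB.
by rewrite -ball_normE /= lpbeta_normE ltcR.
Qed.

Lemma lpbeta_tail_closed i : closed (@lpbeta_tail R p beta p1 beta_gt0 i).
Proof.
move=> y /lpbeta_closure Ay n ni.
have [//|yn0] := eqVneq (y n) 0.
have c0 : 0 < normc (y n) * beta n.
  rewrite mulr_gt0// lt_neqAle normc_ge0 andbT eq_sym.
  by apply: contra_neq yn0; exact: eq0_normc.
have [x Ax yx] := Ay _ c0.
have := normc_le_lpbeta p1 beta_gt0 n (lpbeta_lty (y - x)).
have -> : (y - x) n = y n.
  by rewrite [LHS]/(y n - x n) (Ax _ ni); exact: subr0.
by rewrite leNgt yx.
Qed.

Context {delta : R^nat}.
Hypothesis delta_gt0 : forall n, 0 < delta n.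

Lemma Mz_linear (a : R[i]) (f g : cseq R) :
  Mz delta (a *: f + g) = a *: Mz delta f + Mz delta g.
Proof.
apply/funext => -[|n].
  rewrite [RHS]/(a * Mz delta f 0%N + Mz delta g 0%N) !Mz0.
  by symmetry; transitivity (a * 0 : R[i]); [exact: addr0 | exact: mulr0].
rewrite [RHS]/(a * Mz delta f n.+1 + Mz delta g n.+1) !MzS.
by rewrite [X in _ * X]/(a * f n + g n) mulrDr mulrCA.
Qed.

Hypothesis vS : shift_vanishing (@tail_weight R delta beta 0).

(** The ratio of the norms of consecutive weighted monomials is bounded, since it
tends to [0]. *)
Lemma Mz_bounded : exists2 C, 0 <= C & forall f : cseq R, inlp p beta f ->
  inlp p beta (Mz delta f) /\ N (Mz delta f) <= C * N f.
Proof.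
have [C C0 CP] := shift_bounded (tail_weight_gt0 beta_gt0 delta_gt0 0) vS 1.
exists (C / delta 1%N) => [|f foo]; first by rewrite divr_ge0// ltW.
apply: (lpbeta_norm_shift p1 (j := 1)) => //.
- by rewrite divr_ge0// ltW.
- by move=> [|//] _; rewrite Mz0.
move=> n; rewrite /wmod addn1 MzS normcM normc_real; last first.
  by rewrite divr_ge0 ?mulr_ge0 ?ltW.
have -> : delta n.+1 / (delta n * delta 1%N) * normc (f n) * beta n.+1 =
    (delta n.+1 * beta n.+1) * (normc (f n) / (delta n * delta 1%N)) by ring.
have -> : C / delta 1%N * (normc (f n) * beta n) =
    C * (delta n * beta n) * (normc (f n) / (delta n * delta 1%N)).
  by field; rewrite !gt_eqF.
apply: ler_wpM2r; first by rewrite divr_ge0 ?normc_ge0// mulr_ge0// ltW.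
by have := CP n; rewrite /tail_weight !add0n addn1.
Qed.

Lemma Mz_operator : exists T : {linear V -> V},
  (forall f, T f = Mz delta f :> cseq R) /\ bounded_operator T.
Proof.
have [C C0 CP] := Mz_bounded.
have TP (f : V) : Mz delta f \in in_lpbeta p1 beta_gt0.
  by apply/asboolP; have [] := CP f (lpbeta_lty f).
pose T f : V := Lpbeta (TP f).
have Tlin : linear T.
  by move=> a f g; apply/val_inj; exact: Mz_linear.
pose T' : {linear V -> V} := HB.pack T (GRing.isLinear.Build _ _ _ _ T Tlin).
exists T'; split=> //; exists (C%:C)%C => f.
rewrite !lpbeta_normE -rmorphM lecR.
by have [] := CP f (lpbeta_lty f).
Qed.

End Operator.

(** * Invariant subspaces *)

Section Embedding.
Context {R : realType} {p : R} {delta beta : R^nat}.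
Hypotheses (p1 : 1 <= p) (beta_gt0 : forall n, 0 < beta n)
  (delta_gt0 : forall n, 0 < delta n).
Implicit Types f g : cseq R.
Local Notation w := (@tail_weight R delta beta).

(** The isometry onto the tail of index [i] that conjugates the operator to a
multiple of the unweighted shift. *)
Definition tail_embed i g : cseq R :=
  fun n => if (n < i)%N then 0 else (delta n)%:C%C * g (n - i)%N.

Lemma tail_embedD i f g : tail_embed i (f + g) = tail_embed i f + tail_embed i g.
Proof.
apply/funext => n.
change (tail_embed i (f + g) n = tail_embed i f n + tail_embed i g n :> R[i]).
rewrite /tail_embed.
by case: ifP => _; [exact/esym/(@addr0 R[i]) | exact: mulrDr].
Qed.

Lemma tail_embedZ i (a : R[i]) f : tail_embed i (a *: f) = a *: tail_embed i f.
Proof.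
apply/funext => n.
change (tail_embed i (a *: f) n = a * tail_embed i f n :> R[i]).
rewrite /tail_embed.
by case: ifP => _; [exact/esym/(@mulr0 R[i]) | exact: mulrCA].
Qed.

Lemma tail_embedB i f g : tail_embed i (f - g) = tail_embed i f - tail_embed i g.
Proof. by rewrite -scaleN1r tail_embedD tail_embedZ scaleN1r. Qed.

Lemma Mz_tail_embed i f :
  Mz delta (tail_embed i f) = ((delta 1%N)^-1)%:C%C *: tail_embed i (zshift 1 f).
Proof.
apply/funext => n.
change (Mz delta (tail_embed i f) n =
  ((delta 1%N)^-1)%:C%C * tail_embed i (zshift 1 f) n :> R[i]).
case: n => [|n].
  rewrite Mz0 /tail_embed /zshift; case: ifP => _; first exact/esym/(@mulr0 R[i]).
  by rewrite sub0n /=; transitivity (0 : R[i]) => //; rewrite !mulr0.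
rewrite MzS /tail_embed /zshift; have [ni|] := ltnP n.+1 i.
  by rewrite (ltnW ni); rewrite [RHS]mulr0; exact: mulr0.
rewrite leq_eqVlt => /predU1P[->|]; last first.
  rewrite ltnS => ni; rewrite ltnNge ni/= subSn//= subn1/= !mulrA -!rmorphM/=.
  congr (_%:C%C * _); field; rewrite !gt_eqF//.
rewrite ltnSn subnn/=; transitivity (0 : R[i]); first exact: mulr0.
by rewrite !mulr0.
Qed.

Lemma lpbeta_norm_tail_embed i f : inlp p (w i) f ->
  inlp p beta (tail_embed i f) /\
  lpbeta_norm p beta (tail_embed i f) <= lpbeta_norm p (w i) f.
Proof.
move=> foo; rewrite -[X in _ <= X]mul1r.
apply: (lpbeta_norm_shift p1 (j := i)) => //.
- exact: tail_weight_gt0.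
- by move=> n ni; rewrite /tail_embed ni.
move=> n; rewrite /wmod /tail_embed ltnNge leq_addl/= addnK normcM normc_real; last exact: ltW.
by rewrite mul1r /tail_weight addnC [_ * normc _]mulrC -mulrA.
Qed.

Lemma tail_embed_surj i f : inlp p beta f -> (forall n, (n < i)%N -> f n = 0) ->
  exists2 g, inlp p (w i) g & f = tail_embed i g.
Proof.
move=> foo fi; exists (fun n => (delta (i + n)%N)^-1%:C%C * f (i + n)%N).
  have A0 : 0 <= lpbeta_norm p beta f by exact: lpbeta_norm_ge0.
  apply: proj1 (lpbeta_norm_le p1 (tail_weight_gt0 beta_gt0 delta_gt0 i) A0 _).
  move=> n; apply: le_trans (lpbeta_partial_le p1 beta_gt0 (i + n) foo).
  rewrite big_split_ord/= [leRHS]addrC.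
  apply: le_trans (_ : \sum_(k < n) wmod beta f (i + k)%N `^ p <= _).
    apply: ler_sum => k _; rewrite /wmod normcM normc_real; last by rewrite invr_ge0 ltW.
    rewrite le_eqVlt /tail_weight; apply/orP; left; apply/eqP; congr (_ `^ p).
    by field; rewrite gt_eqF.
  by rewrite lerDl; apply: sumr_ge0 => k _; exact: powR_ge0.
apply/funext => n; rewrite /tail_embed; case: ltnP => ni; first exact: fi.
rewrite subnKC// mulrA -rmorphM/= mulfV ?gt_eqF//.
by transitivity (1 * f n : R[i]); [rewrite mul1r|].
Qed.

Lemma tail_embed0 i f : tail_embed i f i = (delta i)%:C%C * f 0%N.
Proof. by rewrite /tail_embed ltnn subnn. Qed.

End Embedding.

Section Invariant.
Context {R : realType} {p : R} {delta beta : R^nat}.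
Variables (p1 : 1 <= p) (beta_gt0 : forall n, 0 < beta n).
Hypothesis delta_gt0 : forall n, 0 < delta n.
Local Notation V := (lpbeta p1 beta_gt0).
Local Notation w := (@tail_weight R delta beta).
Variable T : {linear V -> V}.
Hypothesis TE : forall f, T f = Mz delta f :> cseq R.

Lemma tail_Lat i : Lat T (@lpbeta_tail R p beta p1 beta_gt0 i).
Proof.
split; first exact: lpbeta_tail_closed.
  split; first by rewrite inE => n _.
  move=> a f g; rewrite !inE => fi gi n ni.
  rewrite [LHS]/(a * f n + g n) fi// gi//.
  by transitivity (a * 0 : R[i]); [exact: addr0 | exact: mulr0].
move=> _ [f fi <-] [|n] ni; first by rewrite TE Mz0.
by rewrite TE MzS fi ?(ltnW ni)//; exact: mulr0.
Qed.

Variable W : set V.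
Hypothesis WLat : Lat T W.

Lemma Lat0 : W 0.
Proof. by case: WLat => _ [/set_mem]. Qed.

Lemma Lat_lin (a : R[i]) (f g : V) : W f -> W g -> W (a *: f + g).
Proof.
case: WLat => _ [_ Wlin] _ Wf Wg; apply/set_mem.
by apply: Wlin; exact/mem_set.
Qed.

Lemma Lat_closure (y : V) : (forall e : R, 0 < e ->
  exists2 x, W x & lpbeta_norm p beta (y - x) < e) -> W y.
Proof. by move=> yW; case: WLat => Wcl _ _; exact/Wcl/lpbeta_closure. Qed.

Lemma Lat_op (f : V) : W f -> W (T f).
Proof. by move=> Wf; case: WLat => _ _; apply; exists f. Qed.

Section At_index.
Variable i : nat.
Local Notation Phi := (@tail_embed R delta i).
Local Notation fin := (inlp p (w i)).

(** The preimage of the subspace under the embedding, as a set of bare coefficient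
sequences. *)
Definition embed_in (g : cseq R) := exists2 x : V, W x & Phi g = x.

Lemma embed_inP (x : V) (g : cseq R) : Phi g = x -> embed_in g -> W x.
Proof. by move=> gx [y Wy gy]; rewrite (_ : x = y)//; apply/val_inj; rewrite /= -gx. Qed.

Lemma embed_in_lin (a : R[i]) (f g : cseq R) :
  embed_in f -> embed_in g -> embed_in (a *: f + g).
Proof.
move=> [x Wx fx] [y Wy gy]; exists (a *: x + y); first exact: Lat_lin.
by rewrite tail_embedD tail_embedZ fx gy.
Qed.

Lemma embed_in0 : embed_in 0.
Proof.
exists 0; first exact: Lat0.
by rewrite -(scale0r 0) tail_embedZ !scale0r.
Qed.

Lemma embed_in_zshift k (f : cseq R) : embed_in f -> embed_in (zshift k f).
Proof.
move=> ef; elim: k => [|k [x Wx fx]].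
  suff -> : zshift 0 f = f by [].
  by apply/funext => n; rewrite /zshift subn0.
exists ((delta 1%N)%:C%C *: T x + 0).
  by apply: Lat_lin; [exact: Lat_op | exact: Lat0].
rewrite addr0; change (Phi (zshift k.+1 f) = (delta 1%N)%:C%C *: (T x : cseq R)).
rewrite TE -fx Mz_tail_embed// scalerA -rmorphM mulfV ?gt_eqF// scale1r.
congr tail_embed; apply/funext => -[//|n]; rewrite /zshift /= ltnS subSS.
by rewrite subn1.
Qed.

Lemma embed_in_cprod_ztrunc n (f q : cseq R) :
  embed_in f -> embed_in (cprod (ztrunc n q) f).
Proof.
move=> ef; elim: n => [|n IHn].
  rewrite ztrunc0 (_ : cprod 0 f = 0); first exact: embed_in0.
  by rewrite -{1}(subrr f) cprodBl subrr.
by rewrite cprod_ztruncS addrC; apply: embed_in_lin => //; exact: embed_in_zshift.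
Qed.

Variable D : R.
Hypotheses (D0 : 0 <= D) (wD : cprod_bounded p (w i) D).
Let w0 n : 0 < w i n. Proof. exact: tail_weight_gt0. Qed.

(** An invariant subspace is an ideal: by continuity of the product, the
polynomial multiples of [f] are dense among all its multiples. *)
Lemma embed_in_cprod (f q : cseq R) :
  fin f -> fin q -> embed_in f -> embed_in (cprod q f).
Proof.
move=> foo qoo ef; have [qfoo _] := wD qoo foo.
have [yoo _] := lpbeta_norm_tail_embed p1 beta_gt0 delta_gt0 qfoo.
have yP : Phi (cprod q f) \in in_lpbeta p1 beta_gt0 by exact/asboolP.
exists (Lpbeta yP) => //; apply: Lat_closure => e e0.
have c0 : 0 < D * lpbeta_norm p (w i) f + 1.
  by rewrite ltr_wpDl// mulr_ge0// lpbeta_norm_ge0.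
have [n qn] := ztrunc_approx p1 w0 qoo (divr_gt0 e0 c0).
have [x Wx fx] := embed_in_cprod_ztrunc n q ef; exists x => //.
suff : lpbeta_norm p beta (Phi (cprod q f) - Phi (cprod (ztrunc n q) f)) < e.
  by rewrite fx.
have [dq _] := lpbeta_normB p1 w0 qoo (ztrunc_inlp p1 w0 n q).
have [dqf dle] := wD dq foo.
rewrite -tail_embedB -cprodBl.
have [_ le1] := lpbeta_norm_tail_embed p1 beta_gt0 delta_gt0 dqf.
apply: le_lt_trans le1 (le_lt_trans dle _).
rewrite mulrAC; apply: le_lt_trans (ler_wpM2l _ qn) _.
  by rewrite mulr_ge0// lpbeta_norm_ge0.
by rewrite mulrA ltr_pdivrMr// mulrC ltr_pM2l// ltrDl.
Qed.

Hypothesis wS : shift_vanishing (w i).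

(** Normalize [f] to constant term [1]: its inverse brings the unit into the
subspace, and multiplying the unit gives everything. *)
Lemma tail_sub_Lat (f : V) : W f -> (forall n, (n < i)%N -> f n = 0) ->
  f i != 0 -> @lpbeta_tail R p beta p1 beta_gt0 i `<=` W.
Proof.
move=> Wf fi fi0 x xi.
have [g0 g0oo fg0] := tail_embed_surj p1 beta_gt0 delta_gt0 (lpbeta_lty f) fi.
have g00 : g0 0%N != 0.
  apply: contra_neq fi0 => g00; rewrite fg0 tail_embed0 g00; exact: mulr0.
(* adding zero puts the scaled series in the shape of [embed_in_lin] *)
pose g : cseq R := (g0 0%N)^-1 *: g0 + 0.
have goo : fin g by rewrite /g addr0; exact: lpbeta_sumZ_lty.
have g1 : g 0%N = 1 by rewrite /g addr0; exact: (@mulVf R[i] _ g00).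
have ge : embed_in g.
  by apply: embed_in_lin; [exists f | exact: embed_in0].
have [h gh] := cprod_inverse g1.
have hoo := inverse_inlp p1 w0 D0 wD wS goo g1 gh.
have onein : embed_in cprod1 by rewrite -gh cprodC; exact: embed_in_cprod.
have onefin : fin cprod1 by rewrite -gh; have [] := wD goo hoo.
have [y yoo xy] := tail_embed_surj p1 beta_gt0 delta_gt0 (lpbeta_lty x) xi.
apply: (embed_inP (esym xy)).
by rewrite -(cprod1l y) cprodC; exact: embed_in_cprod.
Qed.

End At_index.
End Invariant.

Theorem theorem2p6 (R : realType) (p : R) (beta delta : nat -> R)
    (p1 : 1 <= p)
    (beta_gt0 : forall n, 0 < beta n) (delta_gt0 : forall n, 0 < delta n)
    (beta0 : beta 0%N = 1) (delta0 : delta 0%N = 1)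
    (hC : 1 < p -> forall i : nat,
      (C_sup delta beta (conjugate_exponent p) i < +oo)%E)
    (hB : p = 1 -> forall i : nat, exists N : nat,
      [/\ (0 < N)%N, (i <= N)%N & (B_sum delta beta i N < +oo)%E])
    (hb : forall i k : nat, (1 <= k)%N ->
      b_sup delta beta i k M @[M --> \oo] --> 0%E) :
  exists T : {linear lpbeta p1 beta_gt0 -> lpbeta p1 beta_gt0},
    [/\ forall f, T f = Mz delta f :> (nat -> R[i]),
        Lat T = range (@lpbeta_tail R p beta p1 beta_gt0) `|` [set [set 0]] &
        unicellular T].
Proof.
have vS i := shift_vanishing_tail_weight beta_gt0 delta_gt0 (hb i).
have [T [TE Tbd]] := Mz_operator p1 beta_gt0 delta_gt0 (vS 0%N).
have LatE : Lat T = range (@lpbeta_tail R p beta p1 beta_gt0) `|` [set [set 0]].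
  apply/seteqP; split=> [W WLat|W [[i _ <-]|->]]; last 2 first.
  - exact: tail_Lat.
  - split.
    + exact/accessible_closed_set1/hausdorff_accessible/norm_hausdorff.
    + split; first by rewrite inE.
      by move=> a f g; rewrite !inE => -> ->; rewrite scaler0 addr0.
    + by move=> _ [f -> <-]; rewrite linear0.
  have [[x Wx x0]|W0] := pselect (exists2 x, W x & x <> 0); last first.
    right; apply/seteqP; split=> [x Wx|_ ->]; last exact: Lat0 WLat.
    by apply: contrapT => x0; apply: W0; exists x.
  left.
  (* the least index at which some element of [W] does not vanish *)
  have exn : exists n, `[< exists2 f, W f & f n <> 0 >].
    apply: contrapT => nex; apply: x0; apply/val_inj/funext => n.
    by apply: contrapT => xn; apply: nex; exists n; apply/asboolP; exists x.
  case: (ex_minnP exn) => i /asboolP[f Wf /eqP fi0] imin.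
  have Wi g n : W g -> (n < i)%N -> g n = 0.
    move=> Wg ni; apply: contrapT => gn; move: ni; rewrite ltnNge => /negP; apply.
    by apply: imin; apply/asboolP; exists g.
  have [D D0 wD] := cprod_bounded_tail_weight beta_gt0 delta_gt0 p1
    (fun h => hC h i) (fun h => hB h i) (vS i).
  exists i => //; apply/seteqP; split=> [|g Wg n ni]; last exact: Wi.
  apply: (tail_sub_Lat delta_gt0 TE WLat D0 wD (vS i) Wf) => // n ni.
  exact: Wi.
exists T; split => //; split => // W1 W2; rewrite LatE.
have sub0 i : [set 0] `<=` @lpbeta_tail R p beta p1 beta_gt0 i by move=> _ -> n _.
move=> [[i _ <-]|->] [[j _ <-]|->]; [|right; exact: sub0|left; exact: sub0|by left].
have [ij|ji] := leqP i j.
  by right=> f fj n ni; apply: fj; exact: leq_trans ij.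
by left=> f fi n nj; apply: fi; exact: leq_trans (ltnW ji).
Qed.
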